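(* Let $\varrho$ be the substitution on the compact alphabet $\mathcal{A}=\mathbb{N}_0\cup\{\infty\}$ given by $\varrho([0])=[0][1]$, $\varrho([i])=[0][i-1][i+1]$ for integers $i>0$, and $\varrho([\infty])=[0][\infty][\infty]$. For $n\ge 0$ let $\#(n)$ be the number of letters (tiles) of the word $\varrho^n([0])$. Then $$\#(n)\in \frac34\left(\frac52\right)^n+\Theta\left(\frac{2^n}{n^{3/2}}\right).$$ In particular, $r_2=2$, and the discrepancy estimate $$\left|\tfrac34\left(\tfrac52\right)^n-\#(n)\right|\le \theta(n)\,(r_2)^n\qquad (n\ge 1)$$ holds with $\theta(n)=n^{-3/2}$.
   Context: $\mathbb{N}_0=\{0,1,2,\dots\}$; $\mathcal{A}=\mathbb{N}_0\cup\{\infty\}$ is its one-point compactification, and $[i]$ denotes the letter $i\in\mathcal{A}$. The substitution is extended to finite words by concatenation. The substitution operator is the bounded linear operator $M$ on $C(\mathcal{A})$ (continuous functions, sup norm) given by $(Mf)(b)=\sum_{c\in\varrho(b)}f(c)$, where $\varrho(b)$ is regarded as a multiset of letters. Thus $\#(n)=(M^n\mathbf{1})([0])$ with $\mathbf 1$ the constant function $1$. The inflation factor is the spectral radius $\lambda=r(M)=5/2$. The number $r_2$ is defined by $r_2=\sup\{|\lambda'| : \lambda'\in\sigma(M)\setminus\{\lambda\}\}$, where $\sigma(M)$ is the spectrum (over $\mathbb{C}$). Asymptotic notation: for $g(n)>0$ for large $n$, $f\in\Theta(g)$ means that both $\limsup_{n\to\infty}|f(n)|/g(n)$ and $\liminf_{n\to\infty}|f(n)|/g(n)$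 are positive (finite) numbers; $\#(n)\in h(n)+\Theta(g)$ means $\#(n)-h(n)\in\Theta(g)$. *)

(* Defs.v *)
From HB Require Import structures.
From mathcomp Require Import all_boot all_order all_algebra.
From mathcomp Require Import all_classical all_reals all_analysis.
From mathcomp Require Import complex.
Set Implicit Arguments.
Unset Strict Implicit.
Unset Printing Implicit Defensive.
Import Order.TTheory GRing.Theory Num.Theory.
Import ComplexField numFieldNormedType.Exports.
Local Open Scope classical_set_scope.
Local Open Scope ring_scope.

(* Library nat is discrete, so neighbourhoods of infinity are the cofinite
   sets; [Some i] is the letter [i] and [None] the letter [oo]. *)
Notation alphabet := (one_point_compactification nat).

Definition letter (i : nat) : alphabet := Some i.

Definition letter_oo : alphabet := None.

Definition substitution (a : alphabet) : seq alphabet :=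
  match a with
  | Some 0%N => [:: letter 0; letter 1]
  | Some i.+1 => [:: letter 0; letter i; letter i.+2]
  | None => [:: letter 0; letter_oo; letter_oo]
  end.

Definition word_substitution (w : seq alphabet) : seq alphabet :=
  flatten [seq substitution a | a <- w].

Definition tiles (n : nat) : nat :=
  size (iter n word_substitution [:: letter 0]).

(* [R[i]^o] is the complex numbers as a normed module over themselves, with
   the usual topology. *)
Definition continuous_functions (R : realType) :
  {pred alphabet -> R[i]^o} := [pred f | `[< continuous f >]].

Arguments continuous_functions : clear implicits.

Record calphabet (R : realType) := CAlphabet {
  cfun_val :> alphabet -> R[i]^o ;
  cfun_valP : cfun_val \in continuous_functions R }.

Section ContinuousFunctions.
Variable R : realType.

HB.instance Definition _ := [isSub for @cfun_val R].
HB.instance Definition _ := [Choice of calphabet R by <:].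

Lemma continuous_functionsP (f : alphabet -> R[i]^o) :
  reflect (continuous f) (f \in continuous_functions R).
Proof. by rewrite unfold_in; exact: asboolP. Qed.

Lemma continuous_functions_submod : submod_closed (continuous_functions R).
Proof.
split=> [|a f g /continuous_functionsP cf /continuous_functionsP cg].
  by apply/continuous_functionsP; apply: cst_continuous.
apply/continuous_functionsP => x; apply: continuousD; last exact: cg.
by apply: continuousZl_tmp; exact: cf.
Qed.

HB.instance Definition _ :=
  GRing.isSubmodClosed.Build _ _ (continuous_functions R)
    continuous_functions_submod.
HB.instance Definition _ := [SubChoice_isSubLmodule of calphabet R by <:].

Lemma cfun_continuous (f : calphabet R) : continuous f.
Proof. exact/continuous_functionsP/cfun_valP. Qed.

Lemma normc_triangle (x y : R[i]) :
  Normc.normc (x + y) <= Normc.normc x + Normc.normc y.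
Proof. exact: le_normcD. Qed.

Lemma normc_ge0 (x : R[i]) : 0 <= Normc.normc x.
Proof. by case: x => a b; exact: sqrtr_ge0. Qed.

Lemma normcE_norm (x : R[i]) : `|x| = (Normc.normc x)%:C%C.
Proof. by []. Qed.

Lemma continuous_normc : continuous (@Normc.normc R : R[i]^o -> R).
Proof.
move=> x; have xF : Filter (nbhs (x : R[i]^o)) by exact: nbhs_filter.
apply/(@cvgrPdist_lt _ _ _ _ xF) => e e0.
have e0' : 0 < e%:C%C :> R[i] by rewrite ltcR.
near=> y.
have : (Normc.normc (x - y))%:C%C < e%:C%C.
  near: y; apply/nbhs_ballP; exists e%:C%C => //.
rewrite ltcR; apply: le_lt_trans.
have h (a b : R[i]) : Normc.normc a - Normc.normc b <= Normc.normc (a - b).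
  by rewrite lerBlDr; apply: le_trans (normc_triangle _ _); rewrite subrK.
rewrite ler_norml h andbT lerNl opprB.
apply: le_trans (h _ _) _.
by rewrite -normcN opprB.
Unshelve. all: by end_near. Qed.

Definition sup_norm (f : calphabet R) : R :=
  sup (range (fun a => Normc.normc (f a))).

Lemma sup_norm_has_sup (f : calphabet R) :
  has_sup (range (fun a => Normc.normc (f a))).
Proof.
split; first by exists (Normc.normc (f None)), None.
have /compact_bounded [M [Mr]] :
    compact ((fun a => Normc.normc (f a)) @` [set: alphabet]).
  apply: continuous_compact; last exact: one_point_compactification_compact.
  apply: continuous_subspaceT => x.
  by apply: continuous_comp; [exact: cfun_continuous|exact: continuous_normc].
move=> /(_ (M + 1)); rewrite ltrDl => /(_ ltr01) HM.
by exists (M + 1) => y /HM; apply: le_trans (ler_norm _).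
Qed.

Lemma sup_norm_ge (f : calphabet R) a : Normc.normc (f a) <= sup_norm f.
Proof.
by apply: ub_le_sup; [exact: (sup_norm_has_sup f).2|exists a].
Qed.

Lemma sup_norm_le (f : calphabet R) (m : R) :
  (forall a, Normc.normc (f a) <= m) -> sup_norm f <= m.
Proof.
move=> fm; apply: ge_sup; first exact: (sup_norm_has_sup f).1.
by move=> _ [a _ <-].
Qed.

Lemma sup_normD (f g : calphabet R) :
  (sup_norm (f + g))%:C%C <= (sup_norm f)%:C%C + (sup_norm g)%:C%C :> R[i].
Proof.
rewrite -rmorphD lecR; apply: sup_norm_le => a.
by apply: le_trans (normc_triangle _ _) _; apply: lerD; exact: sup_norm_ge.
Qed.

Lemma sup_normZ (l : R[i]) (f : calphabet R) :
  (sup_norm (l *: f))%:C%C = `|l| * (sup_norm f)%:C%C.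
Proof.
rewrite normcE_norm -rmorphM; congr (_ %:C)%C; apply/le_anti/andP; split.
  apply: sup_norm_le => a; rewrite [X in Normc.normc X]/= Normc.normcM.
  by apply: ler_wpM2l; [exact: normc_ge0|exact: sup_norm_ge].
have [->|l0] := eqVneq l 0.
  rewrite Normc.normc0 mul0r; apply: le_trans (sup_norm_ge _ None).
  exact: normc_ge0.
have nl0 : 0 < Normc.normc l.
  rewrite lt_neqAle normc_ge0 andbT eq_sym; apply: contra l0.
  by move=> /eqP/Normc.eq0_normc ->.
rewrite mulrC -ler_pdivlMr//; apply: sup_norm_le => a.
rewrite ler_pdivlMr// mulrC -Normc.normcM.
exact: (sup_norm_ge (l *: f) a).
Qed.

Lemma sup_norm_eq0 (f : calphabet R) : (sup_norm f)%:C%C = 0 :> R[i] -> f = 0.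
Proof.
case=> f0; apply/val_inj/funext => a; apply: Normc.eq0_normc.
by apply/le_anti; rewrite normc_ge0 -{1}f0 sup_norm_ge.
Qed.

HB.instance Definition _ :=
  Lmodule_isNormed.Build R[i] (calphabet R) sup_normD sup_normZ sup_norm_eq0.

Lemma nbhs_letter_oo (P : set alphabet) :
  nbhs letter_oo P <-> P letter_oo /\ \forall n \near \oo, P (letter n).
Proof.
split=> [nP|[P0 [N _ NP]]].
  split; first exact: nbhs_singleton.
  case: nP => W [cW _] WP.
  have /compact_bounded [M [Mr MW]] : compact ((fun n => n%:R : R) @` W).
    apply: continuous_compact => //; apply: continuous_subspaceT => n U.
    by move=> /nbhs_singleton nU; apply/principal_filterP.
  near=> n; apply: WP; left; exists n => // Wn.
  have /MW/(_ _ (imageP _ Wn)) : M < M + 1 by rewrite ltrDl.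
  apply/negP; rewrite -ltNge; apply: lt_le_trans (ler_norm _).
  by near: n; exact: nbhs_infty_gtr.
exists `I_N.
  split; last exact: discrete_closed.
  exact/finite_compact/finite_II.
move=> b [[n /negP Nn <-]|->//].
by apply: NP => /=; rewrite leqNgt.
Unshelve. all: by end_near. Qed.

Definition substitution_fun (f : alphabet -> R[i]^o) : alphabet -> R[i]^o :=
  fun b => \sum_(c <- substitution b) f c.

Lemma substitution_fun_continuous (f : calphabet R) :
  substitution_fun f \in continuous_functions R.
Proof.
apply/continuous_functionsP => -[n|].
  by move=> U /nbhs_singleton HU; apply/principal_filterP.
have fn : f (letter n) @[n --> \oo] --> f letter_oo.
  by move=> U /cfun_continuous /nbhs_letter_oo[].
have Mfn : substitution_fun f (letter n) @[n --> \oo]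
    --> substitution_fun f letter_oo.
  rewrite -cvg_shiftS /substitution_fun /= !big_cons big_nil addr0.
  under eq_fun do rewrite !big_cons big_nil addr0.
  apply: cvgD; first exact: cvg_cst.
  apply: cvgD => //.
  by have := fn; rewrite -(cvg_shiftn 2); under eq_fun do rewrite addn2.
move=> U HU; apply/nbhs_letter_oo; split; first exact: (nbhs_singleton HU).
exact: (Mfn U HU).
Qed.

Definition substitution_operator (f : calphabet R) : calphabet R :=
  CAlphabet (substitution_fun_continuous f).

Lemma substitution_operator_linear : linear substitution_operator.
Proof.
move=> a f g; apply/val_inj/funext => b.
transitivity (\sum_(c <- substitution b) (a *: f c + g c)); first by [].
by rewrite big_split -scaler_sumr.
Qed.

HB.instance Definition _ :=
  GRing.isLinear.Build R[i] (calphabet R) (calphabet R) _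
    substitution_operator substitution_operator_linear.

End ContinuousFunctions.

Definition resolvent_set (K : numFieldType) (V : normedModType K)
    (T : V -> V) : set K :=
  [set z | exists S : {linear V -> V}, [/\ continuous S,
     forall v, S (z *: v - T v) = v & forall v, z *: S v - T (S v) = v]].

Definition spectrum (K : numFieldType) (V : normedModType K)
    (T : V -> V) : set K := ~` resolvent_set T.

(* [sup] is 0 on sets that are empty or unbounded above; neither occurs for
   the spectrum of a bounded operator on a nonzero complex Banach space. *)
Definition spectral_radius (R : realType) (V : normedModType R[i])
    (T : V -> V) : R :=
  sup [set Normc.normc z | z in spectrum T].

Definition inflation_factor (R : realType) : R :=
  spectral_radius (@substitution_operator R).

Definition second_radius (R : realType) : R :=
  sup [set Normc.normc z |
       z in spectrum (@substitution_operator R)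
            `\ (inflation_factor R)%:C%C].

Definition Theta (R : realType) (g : nat -> R) : set (nat -> R) :=
  [set f | let u := fun n => (`|f n| / g n)%:E in
     [/\ \forall n \near \oo, 0 < g n,
         (0 < limn_esup u < +oo)%E & (0 < limn_einf u < +oo)%E]].

(* Main.v *)
From HB Require Import structures.
Require Import Defs.
From mathcomp Require Import all_boot all_order all_algebra.
From mathcomp Require Import all_classical all_reals all_analysis.
From mathcomp Require Import complex.
From mathcomp Require Import zify ring lra.
Set Implicit Arguments.
Unset Strict Implicit.
Unset Printing Implicit Defensive.
Import Order.TTheory GRing.Theory Num.Theory.
Import ComplexField numFieldNormedType.Exports.
Local Open Scope classical_set_scope.
Local Open Scope ring_scope.

(** Write [T f l = f (l+1) + f (l-1)], with [f (-1) = 0], for the adjacency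
    operator of the half-line. On the finite letters the substitution
    operator is [M f = f 0 + T f], a rank-one perturbation of [T], and both
    halves of the theorem come from comparing [M] with [T].

    Asymptotics. Although [M] restarts at the letter 0, it is conjugate to
    [T]: the triangular map [U f l = f l + sum_(k < l) 2^(l-k-1) f k]
    satisfies [U M = T U] ([intertwiner_subst]), fixes the value at 0 and
    sends the constant 1 to [2^l]. Hence the number of tiles is [(T^n
    2^l)(0)] ([tilesE]). Since [2^l - 2^(-l-2)] vanishes at [l = -1], it is
    an eigenvector of [T] for 5/2, with value 3/4 at 0; so the discrepancy
    [d_n] is exactly [(T^n 2^(-l-2))(0)], a positive quantity of size at
    most [2^n / 4] ([tiles_discrepancy]). The function [2^(-l-2)] is itself
    an eigenvector up to a multiple of the Dirac mass at 0, whence [d_(n+1)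
    = 5/2 d_n - c_n / 2], where [c_n] counts closed walks of the half-line:
    Catalan numbers for even [n], zero for odd [n] ([discrepancyS],
    [closed_walks_double]). Read backwards this recursion is a contraction,
    so that [d_2k] lies between [Cat_k / 5] and [5/9 Cat_k]; bounds on the
    central binomial coefficient then give the order [2^n / n^(3/2)]
    together with the constant 1 ([discrepancy_normalized_bounds]).

    Spectrum. The function [2 - 2^(-l)] is an eigenvector of [M] for 5/2,
    and 2 is in the spectrum because [2 - M] misses the Dirac mass at 0: a
    preimage would be [- l] at the letter [l]. If [|z| > 2], write [z = u +
    1/u] with [|u| < 1]; the factorization [(1 - u S) (1 - u L) = u (z - T)]
    into shifts inverts [z - T] ([path_op_solution]), and the rank-one
    perturbation is invertible as well unless [((z - T)^-1 1)(0) = u / (1 -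
    u)] equals 1, that is unless [z = 5/2] ([resolvent_outside]). *)

(** * Geometric sequences *)

Lemma geometric_eventually_le (R : realType) (q e c : R) :
  0 <= q < 1 -> 0 < e ->
  \forall n \near \oo, c * q ^+ n <= e.
Proof.
move=> /andP[q0 q1] e0; have : c * q ^+ n @[n --> \oo] --> c * 0.
  by apply: cvgMr; apply: cvg_expr; rewrite ger0_norm.
rewrite mulr0 => /cvgrPdist_le /(_ _ e0) [N _ cN]; exists N => // n /cN /=.
by rewrite sub0r normrN; apply: le_trans (ler_norm _).
Qed.

(** This makes the constant of a crude a priori bound disappear once an
    estimate that contracts by [q] has been iterated. *)
Lemma geometric_le0 (R : realType) (q x c : R) :
  0 <= q < 1 -> (forall n, x <= c * q ^+ n) -> x <= 0.
Proof.
move=> q01 xq; rewrite leNgt; apply/negP => x0; have x2 : 0 < x / 2 by lra.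
have [N _ /(_ N (leqnn N)) /= cN] := geometric_eventually_le c q01 x2.
by have := xq N; lra.
Qed.

(** The intervals of radius [c / (1 - r) * r ^+ n] around [s n] are nested. *)
Lemma geometric_cauchy (R : realType) (s : nat -> R) (c r : R) : 0 <= r < 1 ->
    (forall n, `|s n.+1 - s n| <= c * r ^+ n) ->
  exists l, forall n, `|s n - l| <= c / (1 - r) * r ^+ n.
Proof.
move=> /andP[r0 r1] sr; pose e n := c / (1 - r) * r ^+ n.
have eE n : e n = c * r ^+ n + e n.+1.
  by rewrite /e exprS; field; apply: lt0r_neq0; lra.
have e0 n : 0 <= e n.
  have c0 : 0 <= c by have := le_trans (normr_ge0 _) (sr 0%N); rewrite mulr1.
  by rewrite /e mulr_ge0 ?exprn_ge0// divr_ge0//; lra.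
pose lo n := s n - e n; pose hi n := s n + e n.
have loS : {homo lo : m n / (m <= n)%N >-> m <= n}.
  apply: homo_leq => // [x y v|n]; first exact: le_trans.
  by have := sr n; rewrite /lo (eE n) ler_norml; lra.
have hiS : {homo hi : m n / (m <= n)%N >-> n <= m}.
  apply: homo_leq => // [x y v xy yv|n]; first exact: le_trans yv xy.
  by have := sr n; rewrite /hi (eE n) ler_norml; lra.
have lohi m n : lo m <= hi n.
  have H k : lo k <= hi k by have := e0 k; rewrite /lo /hi; lra.
  have [mn|/ltnW nm] := leqP m n; first exact: le_trans (loS _ _ mn) (H n).
  exact: le_trans (H m) (hiS _ _ nm).
have ub n : ubound (range lo) (hi n) by move=> _ [m _ <-].
have ne : range lo !=set0 by exists (lo 0%N), 0%N.
exists (sup (range lo)) => n.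
have l1 : lo n <= sup (range lo).
  by apply: ub_le_sup; [exists (hi 0%N); exact: ub|exists n].
have l2 : sup (range lo) <= hi n by exact: ge_sup.
by move: l1 l2; rewrite /lo /hi -/(e n) ler_norml; lra.
Qed.

(** * The path operator *)

Definition path_op (K : nzRingType) (f : nat -> K) (l : nat) : K :=
  f l.+1 + (if l is k.+1 then f k else 0).

Arguments path_op {K} f l.

Section PathOperator.
Variable K : comNzRingType.
Implicit Types f g : nat -> K.

Lemma eq_path_op f g : f =1 g -> path_op f =1 path_op g.
Proof. by move=> fg [|l]; rewrite /path_op !fg. Qed.

Lemma eq_iter_path_op n f g :
  f =1 g -> iter n path_op f =1 iter n path_op g.
Proof. by move=> fg; elim: n => //= n; exact: eq_path_op. Qed.

Lemma path_opD f g l :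
  path_op (fun i => f i + g i) l = path_op f l + path_op g l.
Proof. by case: l => [|l]; rewrite /path_op ?addr0 // addrACA. Qed.

Lemma path_opZ a f l : path_op (fun i => a * f i) l = a * path_op f l.
Proof. by case: l => [|l]; rewrite /path_op ?addr0 // mulrDr. Qed.

Lemma iter_path_op_lin n a b f g l :
  iter n path_op (fun i => a * f i + b * g i) l =
  a * iter n path_op f l + b * iter n path_op g l.
Proof.
elim: n l => //= n IHn l.
by rewrite (eq_path_op IHn) path_opD !path_opZ.
Qed.

Lemma iter_path_op_eigen n a f :
    (forall l, path_op f l = a * f l) ->
  forall l, iter n path_op f l = a ^+ n * f l.
Proof.
move=> fE; elim: n => [|n IHn] l /=; first by rewrite mul1r.
by rewrite (eq_path_op IHn) path_opZ fE mulrA exprSr.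
Qed.

End PathOperator.

(** * Tile counts as walk counts *)

Section Tiles.
Variable R : realType.
Local Notation T := (@path_op R).
Implicit Types f : nat -> R.

Definition subst_op f (l : nat) : R := f 0%N + T f l.

(** In closed form, [f l + sum_(k < l) 2^(l-k-1) f k]; the recursion is what
    the commutation with [T] needs. *)
Fixpoint intertwiner f (l : nat) : R :=
  if l is k.+1 then 2 * intertwiner f k + f k.+1 - f k else f 0%N.

(** Both sides obey the same three-term recursion, so two consecutive values
    are carried along the induction. *)
Lemma intertwiner_subst f : intertwiner (subst_op f) =1 T (intertwiner f).
Proof.
suff H l : intertwiner (subst_op f) l = T (intertwiner f) l /\
           intertwiner (subst_op f) l.+1 = T (intertwiner f) l.+1.
  by move=> l; case: (H l).
elim: l => [|l [IHl IHl1]]; first by rewrite /subst_op /path_op /=; split; ring.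
split=> //; rewrite -[LHS]/(2 * intertwiner (subst_op f) l.+1
  + subst_op f l.+2 - subst_op f l.+1) IHl1 /subst_op /path_op /=.
by ring.
Qed.

Lemma intertwiner_iter n f :
  intertwiner (iter n subst_op f) =1 iter n T (intertwiner f).
Proof.
elim: n => //= n IHn l.
by rewrite intertwiner_subst; apply: eq_path_op.
Qed.

Lemma iter_word_cat n (v w : seq alphabet) :
  iter n word_substitution (v ++ w) =
  iter n word_substitution v ++ iter n word_substitution w.
Proof.
by elim: n => //= n ->; rewrite /word_substitution map_cat flatten_cat.
Qed.

Lemma size_iter_word n (w : seq alphabet) :
  size (iter n word_substitution w) =
  (\sum_(a <- w) size (iter n word_substitution [:: a]))%N.
Proof.
elim: w => [|a w IHw]; first by rewrite big_nil; elim: n => //= n /size0nil ->.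
by rewrite big_cons -cat1s iter_word_cat size_cat IHw.
Qed.

(** Peeling off the first substitution instead of the last one makes the counts
    iterates of [subst_op]. *)
Lemma size_iter_letter n l :
  (size (iter n word_substitution [:: letter l]))%:R =
  iter n subst_op (fun=> 1) l :> R.
Proof.
elim: n l => // n IHn l.
rewrite iterSr iterS /word_substitution /= cats0 size_iter_word.
by case: l => [|l] /=; rewrite !big_cons big_nil !natrD !IHn /subst_op /path_op;
  ring.
Qed.

Lemma tilesE n : (tiles n)%:R = iter n T (fun l => 2 ^+ l) 0%N :> R.
Proof.
rewrite /tiles size_iter_letter -[LHS]/(intertwiner _ 0) intertwiner_iter.
apply: eq_iter_path_op.
have H l : intertwiner (fun=> 1) l = 2 ^+ l.
  by elim: l => //= l ->; rewrite exprS; ring.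
exact: H.
Qed.

(** The weight [2^-(l+2)] is the mirror image of [2^l] in the point [-1]; only
    the difference of the two exponentials satisfies the boundary condition. *)
Definition discrepancy n : R := iter n T (fun l => 2^-1 ^+ l.+2) 0%N.

Lemma tiles_discrepancy n :
  (tiles n)%:R = 3 / 4 * (5 / 2) ^+ n + discrepancy n :> R.
Proof.
rewrite tilesE /discrepancy.
(* This combination vanishes at [l = -1], as the boundary condition requires. *)
pose g l : R := 2 ^+ l - 2^-1 ^+ l.+2.
have gE l : T g l = 5 / 2 * g l.
  by case: l => [|l]; rewrite /path_op /g !exprS ?expr0; field.
have -> : iter n T (fun l => 2 ^+ l) 0%N =
    iter n T (fun l => 1 * g l + 1 * 2^-1 ^+ l.+2) 0%N.
  by apply: eq_iter_path_op => l; rewrite !mul1r subrK.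
rewrite iter_path_op_lin !mul1r (iter_path_op_eigen _ gE); congr (_ + _).
by rewrite /g; field.
Qed.

Lemma path_op_ge0 f : (forall l, 0 <= f l) -> forall l, 0 <= T f l.
Proof. by move=> f0 [|l]; rewrite /path_op ?addr0// addr_ge0. Qed.

Lemma discrepancy_ge0 n : 0 <= discrepancy n.
Proof.
suff H l : 0 <= iter n T (fun l => 2^-1 ^+ l.+2) l by exact: H.
elim: n l => /= [l|n IHn l]; last exact: path_op_ge0.
by rewrite exprn_ge0// invr_ge0.
Qed.

Lemma iter_path_op_le n f (c : R) :
  (forall l, f l <= c) -> 0 <= c -> forall l, iter n T f l <= 2 ^+ n * c.
Proof.
move=> fc c0; elim: n => [|n IHn] l /=; first by rewrite mul1r.
have H : 0 <= 2 ^+ n * c by rewrite mulr_ge0// exprn_ge0.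
by rewrite /path_op exprS -mulrA mulr2n mulrDl mul1r lerD//; case: l.
Qed.

Lemma discrepancy_le n : discrepancy n <= 2 ^+ n * (1 / 4).
Proof.
apply: iter_path_op_le => // l.
rewrite !exprS mulrA [X in _ <= X](_ : _ = 2^-1 * 2^-1 * 1); last by field.
by rewrite ler_pM2l ?exprn_ile1 ?invf_le1 ?ler1n//; lra.
Qed.

Definition closed_walks n : R := iter n T (fun l => (l == 0%N)%:R) 0%N.

(** The weight [2^-(l+2)] fails to be an eigenvector only at the boundary,
    where its value 1/2 at [-1] is cut off. *)
Lemma discrepancyS n :
  discrepancy n.+1 = 5 / 2 * discrepancy n - 2^-1 * closed_walks n.
Proof.
rewrite /discrepancy iterSr.
have E : T (fun l => 2^-1 ^+ l.+2) =1
  fun l => 5 / 2 * 2^-1 ^+ l.+2 + (- 2^-1) * (l == 0%N)%:R.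
  by case=> [|l]; rewrite /path_op /= !exprS ?expr0; lra.
by rewrite (eq_iter_path_op _ E) iter_path_op_lin mulNr.
Qed.

(** * Closed walks and Catalan numbers *)

(** These numbers count the walks with [n] unit steps on the integers from 0 to
    [j]; the parity test excludes the unreachable end points. *)
Definition free_walks n j : R :=
  if odd (n + j) then 0 else ('C(n, (n + j)./2))%:R.

Lemma free_walksSS n j :
  free_walks n.+1 j.+1 = free_walks n j + free_walks n j.+2.
Proof.
rewrite /free_walks !addnS !addSn /= !negbK; case: ifP => _.
  by rewrite addr0.
by rewrite binS natrD addrC.
Qed.

Lemma free_walksS0 n : free_walks n.+1 0 = 2 * free_walks n 1.
Proof.
rewrite /free_walks !addn0 addn1 /=; case: ifP; first by rewrite mulr0.
move=> /negbT; rewrite negbK => n_odd.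
have [m ->] : exists m, n = m.*2.+1.
  by exists n./2; rewrite -[LHS]odd_double_half n_odd.
rewrite -[uphalf _]/m.*2./2.+1 doubleK binS mulr2n mulrDl mul1r natrD.
congr (_ + _).
by rewrite -[in RHS]bin_sub -addnn ?ltnS ?leq_addr// subSS addnK.
Qed.

(** Reflection principle: walks from [l] to 0 that avoid [-1] are all walks
    minus those from the mirror image [- l - 2]. *)
Lemma iter_path_op_delta n l :
  iter n T (fun l => (l == 0%N)%:R) l = free_walks n l - free_walks n l.+2.
Proof.
elim: n l => [|n IHn] l.
  have W j : free_walks 0 j.+1 = 0.
    by rewrite /free_walks; case: j => [|j] //=; case: ifP.
  by rewrite W subr0; case: l.
rewrite iterS (eq_path_op IHn) /path_op; case: l => [|l].
  by rewrite free_walksS0 free_walksSS; ring.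
by rewrite !free_walksSS; ring.
Qed.

Lemma closed_walks_doubleS k : closed_walks k.*2.+1 = 0.
Proof.
rewrite /closed_walks iter_path_op_delta /free_walks addn0 addn2 /= negbK.
by rewrite odd_double subr0.
Qed.

Lemma closed_walks_double k :
  k.+1%:R * closed_walks k.*2 = ('C(k.*2, k))%:R.
Proof.
rewrite /closed_walks iter_path_op_delta /free_walks addn0 addn2 /= negbK.
rewrite odd_double doubleK mulrBr.
rewrite -[X in _ - X]natrM mul_bin_left -addnn addnK natrM.
by rewrite -mulrBl -natrB// subSnn mul1r.
Qed.

Definition scaled_central k : R := ('C(k.*2, k))%:R / 4 ^+ k.

Lemma scaled_centralS k :
  (2 * k%:R + 2) * scaled_central k.+1 = (2 * k%:R + 1) * scaled_central k.
Proof.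
(* Cleared of factorials, this is the ratio of consecutive binomials. *)
have E : (k.+1 * k.+1 * 'C(k.+1.*2, k.+1) = k.*2.+2 * k.*2.+1 * 'C(k.*2, k))%N.
  apply/eqP; rewrite -(eqn_pmul2r (fact_gt0 k)) -(eqn_pmul2r (fact_gt0 k)).
  have /= := @bin_fact k.+1.*2 k.+1; have := @bin_fact k.*2 k.
  rewrite -!addnn !addnK !leq_addl => /(_ isT) A /(_ isT).
  rewrite addSn addnS !factS => B.
  apply/eqP; nia.
have {}E : (k%:R + 1) * (k%:R + 1) * ('C(k.+1.*2, k.+1))%:R =
    (2 * k%:R + 2) * (2 * k%:R + 1) * ('C(k.*2, k))%:R :> R.
  have -> : 2 * k%:R + 1 = k.*2.+1%:R :> R by rewrite -[RHS]natr1 -mul2n natrM.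
  have -> : 2 * k%:R + 2 = k.*2.+2%:R :> R.
    by rewrite -mul2n -[in RHS]addn2 natrD natrM.
  by rewrite natr1 -!natrM E.
have h : 4 ^+ k != 0 :> R by rewrite expf_neq0.
have h1 : k%:R + 1 != 0 :> R by rewrite natr1 pnatr_eq0.
rewrite /scaled_central exprS; move: ('C(_, _)%:R) ('C(_, _)%:R) E => d c E.
have -> : c = (2 * k%:R + 2) * (2 * k%:R + 1) * d / ((k%:R + 1) * (k%:R + 1)).
  by rewrite -E; field.
by field; rewrite h h1.
Qed.

Lemma scaled_central_ge0 k : 0 <= scaled_central k.
Proof. by rewrite divr_ge0// exprn_ge0. Qed.

(** The factor 3 matters: with [2 * k%:R + 1] instead, the bound obtained for
    the discrepancy would be a multiple of [2^n / n^(3/2)] by a constant larger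
    than 1. *)
Lemma scaled_central_le k : (3 * k%:R + 1) * scaled_central k ^+ 2 <= 1.
Proof.
elim: k => [|k IHk]; first by rewrite /scaled_central bin0 expr0 divr1; lra.
have := scaled_centralS k.
have := scaled_central_ge0 k; have := scaled_central_ge0 k.+1.
rewrite -[k.+1%:R]natr1; have : (0 : R) <= k%:R by [].
move: (scaled_central k) (scaled_central k.+1) (k%:R : R) IHk.
move=> x y t IH t0 y0 x0 E.
have -> : y = (2 * t + 1) * x / (2 * t + 2).
  by rewrite -E; field; apply: lt0r_neq0; lra.
rewrite expr_div_n mulrA ler_pdivrMr; last by rewrite exprn_gt0//; lra.
apply: (@le_trans _ _ ((2 * t + 2) ^+ 2 * ((3 * t + 1) * x ^+ 2))); last first.
  by rewrite mulrC ler_pM2r// exprn_gt0//; lra.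
rewrite exprMn [leLHS]mulrA [leRHS]mulrA ler_wpM2r ?sqr_ge0//; nra.
Qed.

Lemma scaled_central_ge k : 1 <= (4 * k%:R + 1) * scaled_central k ^+ 2.
Proof.
elim: k => [|k IHk]; first by rewrite /scaled_central bin0 expr0 divr1; lra.
have := scaled_centralS k.
have := scaled_central_ge0 k; have := scaled_central_ge0 k.+1.
rewrite -[k.+1%:R]natr1; have : (0 : R) <= k%:R by [].
move: (scaled_central k) (scaled_central k.+1) (k%:R : R) IHk.
move=> x y t IH t0 y0 x0 E.
have -> : y = (2 * t + 1) * x / (2 * t + 2).
  by rewrite -E; field; apply: lt0r_neq0; lra.
rewrite expr_div_n mulrA ler_pdivlMr; last by rewrite exprn_gt0//; lra.
apply: (@le_trans _ _ ((2 * t + 2) ^+ 2 * ((4 * t + 1) * x ^+ 2))).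
  by rewrite mulrC ler_pM2l// exprn_gt0//; lra.
rewrite exprMn [leLHS]mulrA [leRHS]mulrA ler_wpM2r ?sqr_ge0//; nra.
Qed.

Definition scaled_catalan k : R := closed_walks k.*2 / 4 ^+ k.

Lemma scaled_catalanE k : (k%:R + 1) * scaled_catalan k = scaled_central k.
Proof.
by rewrite /scaled_catalan /scaled_central mulrA natr1 closed_walks_double.
Qed.

Lemma scaled_catalanS k : scaled_catalan k.+1 <= scaled_catalan k.
Proof.
have := scaled_catalanE k.+1.
have := scaled_centralS k; have := scaled_central_ge0 k.
rewrite -scaled_catalanE -[k.+1%:R]natr1; have : (0 : R) <= k%:R by [].
move: (scaled_catalan k) (scaled_central k.+1) (k%:R : R) (scaled_catalan k.+1).
move=> c x t d t0 c0 Ex Ed.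
have c0' : 0 <= c by move: c0; rewrite pmulr_rge0//; lra.
rewrite -Ed in Ex.
rewrite -(@ler_pM2l _ ((2 * t + 2) * (t + 2))); last by rewrite mulr_gt0; lra.
have -> : (2 * t + 2) * (t + 2) * d = (2 * t + 1) * (t + 1) * c.
  by rewrite -[RHS]mulrA -Ex; ring.
by rewrite ler_wpM2r//; nra.
Qed.

Lemma scaled_catalan_ge0 k : 0 <= scaled_catalan k.
Proof.
have := scaled_central_ge0 k.
by rewrite -scaled_catalanE pmulr_rge0// natr1 ltr0n.
Qed.

(** * The size of the discrepancy *)

Lemma expr2_double k : 2 ^+ k.*2 = 4 ^+ k :> R.
Proof. by rewrite -mul2n exprM; congr (_ ^+ k); rewrite expr2; ring. Qed.

Definition scaled_discrepancy k := discrepancy k.*2 / 4 ^+ k.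

(** Two steps of [discrepancyS], solved for the earlier term: forwards the
    factor 25/16 amplifies errors, backwards they shrink. *)
Lemma scaled_discrepancyE k :
  scaled_discrepancy k =
  16 / 25 * scaled_discrepancy k.+1 + 5^-1 * scaled_catalan k.
Proof.
rewrite /scaled_discrepancy /scaled_catalan doubleS !discrepancyS.
rewrite closed_walks_doubleS exprS.
by field; rewrite expf_neq0.
Qed.

Lemma scaled_discrepancy_ge0 k : 0 <= scaled_discrepancy k.
Proof. by rewrite divr_ge0 ?discrepancy_ge0// exprn_ge0. Qed.

Lemma scaled_discrepancy_bound k : scaled_discrepancy k <= 1 / 4.
Proof.
by rewrite ler_pdivrMr ?exprn_gt0// mulrC -expr2_double discrepancy_le.
Qed.

Lemma scaled_discrepancy_ge k : 5^-1 * scaled_catalan k <= scaled_discrepancy k.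
Proof.
have := scaled_discrepancy_ge0 k.+1.
by rewrite (scaled_discrepancyE k); lra.
Qed.

(** As the Catalan numbers scaled by [4^k] decrease, the bound [a] for the next
    ratio to them yields [16/25 a + 1/5] for this one, and 5/9 is the fixed
    point of that map. *)
Lemma scaled_discrepancy_le k :
  scaled_discrepancy k <= 5 / 9 * scaled_catalan k.
Proof.
have H n j : scaled_discrepancy j - 5 / 9 * scaled_catalan j <= (16 / 25) ^+ n.
  elim: n j => [|n IHn] j.
    have := scaled_discrepancy_bound j; have := scaled_catalan_ge0 j.
    by rewrite expr0; lra.
  have := IHn j.+1; have := scaled_catalanS j.
  rewrite (scaled_discrepancyE j) exprS.
  by move: (_ ^+ n) => e; lra.
rewrite -subr_le0; apply: (@geometric_le0 _ (16 / 25) _ 1).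
  by apply/andP; split; lra.
by move=> n; rewrite mul1r.
Qed.

(** Closed walks of odd length do not exist, so odd indices cost nothing. *)
Lemma discrepancy_doubleS k :
  discrepancy k.*2.+1 = 2 / 5 * discrepancy k.+1.*2.
Proof.
rewrite doubleS [discrepancy k.*2.+2]discrepancyS closed_walks_doubleS.
by field.
Qed.

(** With [(k+1) scaled_catalan k = scaled_central k], the two-sided bounds on
    central binomials reduce a comparison with Catalan numbers to polynomial
    inequalities in [k] and [y]. *)
Lemma scaled_bounds_of_catalan k (c d t y : R) : 0 <= d -> 0 <= y ->
    d * scaled_catalan k <= t <= c * scaled_catalan k ->
    (k%:R + 1) ^+ 2 * (4 * k%:R + 1) <= 1600 * d ^+ 2 * y ^+ 3 ->
    c ^+ 2 * y ^+ 3 <= (k%:R + 1) ^+ 2 * (3 * k%:R + 1) ->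
  1 / 1600 <= t ^+ 2 * y ^+ 3 <= 1.
Proof.
move=> d0 y0 /andP[dt tc] lo hi.
have y3 : 0 <= y ^+ 3 by exact: exprn_ge0.
have a0 := scaled_catalan_ge0 k.
have a2 : 0 <= scaled_catalan k ^+ 2 by exact: sqr_ge0.
have da0 : 0 <= d * scaled_catalan k by exact: mulr_ge0.
have t0 := le_trans da0 dt.
have t_ge : (d * scaled_catalan k) ^+ 2 <= t ^+ 2 by rewrite ler_sqr.
have t_le : t ^+ 2 <= (c * scaled_catalan k) ^+ 2.
  by rewrite ler_sqr// nnegrE (le_trans t0).
have := ler_wpM2r y3 t_ge; have := ler_wpM2r y3 t_le.
have := ler_wpM2r a2 lo; have := ler_wpM2r a2 hi.
have := scaled_central_le k; have := scaled_central_ge k.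
rewrite -scaled_catalanE !exprMn.
by lra.
Qed.

(** Squares avoid the exponent 3/2, and 1/1600 is a convenient square below the
    true lower bound. *)
Lemma discrepancy_normalized_bounds n : (0 < n)%N ->
  1 / 1600 <= (discrepancy n / 2 ^+ n) ^+ 2 * n%:R ^+ 3 <= 1.
Proof.
rewrite -(odd_double_half n); case: (odd n); move: n./2 => k /=.
  move=> _; rewrite add1n.
  have -> : discrepancy k.*2.+1 / 2 ^+ k.*2.+1 =
      4 / 5 * scaled_discrepancy k.+1.
    rewrite discrepancy_doubleS /scaled_discrepancy !exprS expr2_double.
    by field; rewrite expf_neq0.
  apply: (@scaled_bounds_of_catalan k.+1 (4 / 9) (4 / 25)) => //.
  - have := scaled_discrepancy_ge k.+1; have := scaled_discrepancy_le k.+1.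
    by lra.
  - rewrite -[k.+1%:R]natr1 -[k.*2.+1%:R]natr1 -mul2n natrM.
    have : (0 : R) <= k%:R by []; move: k%:R => x x0.
    by have := exprn_ge0 2 x0; have := exprn_ge0 3 x0; lra.
  - rewrite -[k.+1%:R]natr1 -[k.*2.+1%:R]natr1 -mul2n natrM.
    have : (0 : R) <= k%:R by []; move: k%:R => x x0.
    by have := exprn_ge0 2 x0; have := exprn_ge0 3 x0; lra.
rewrite add0n; case: k => // k _.
rewrite expr2_double -/(scaled_discrepancy k.+1).
apply: (@scaled_bounds_of_catalan k.+1 (5 / 9) 5^-1) => //.
- by rewrite scaled_discrepancy_ge scaled_discrepancy_le.
- rewrite -mul2n natrM -[k.+1%:R]natr1.
  have : (0 : R) <= k%:R by []; move: k%:R => x x0.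
  by have := exprn_ge0 2 x0; have := exprn_ge0 3 x0; lra.
- rewrite -mul2n natrM -[k.+1%:R]natr1.
  have : (0 : R) <= k%:R by []; move: k%:R => x x0.
  by have := exprn_ge0 2 x0; have := exprn_ge0 3 x0; lra.
Qed.

End Tiles.

Lemma Theta_bounds (R : realType) (f g : nat -> R) (c C : R) :
    0 < c -> (\forall n \near \oo, 0 < g n) ->
    (\forall n \near \oo, c <= `|f n| / g n <= C) ->
  Theta g f.
Proof.
move=> c0 g0 fg; pose u n := (`|f n| / g n)%:E.
have lo : (c%:E <= limn_einf u)%E.
  rewrite limn_einf_lim; apply: lime_ge; first exact: is_cvg_einfs.
  case: fg => N _ fg; exists N => // n /= Nn.
  apply: le_ereal_inf_tmp => _ [m /= nm <-].
  by rewrite lee_fin; case/andP: (fg m (leq_trans Nn nm)).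
have hi : (limn_esup u <= C%:E)%E.
  rewrite limn_esup_lim; apply: lime_le; first exact: is_cvg_esups.
  case: fg => N _ fg; exists N => // n /= Nn.
  apply: ge_ereal_sup => _ [m /= nm <-].
  by rewrite lee_fin; case/andP: (fg m (leq_trans Nn nm)).
have mid := limn_einf_sup u.
have c0' : (0 < c%:E)%E by rewrite lte_fin.
split=> //; apply/andP; split.
- exact: lt_le_trans c0' (le_trans lo mid).
- exact: le_lt_trans hi (ltry _).
- exact: lt_le_trans c0' lo.
- exact: le_lt_trans (le_trans mid hi) (ltry _).
Qed.

Lemma discrepancy_scaled_bounds (R : realType) n : (0 < n)%N ->
  1 / 40 <= discrepancy R n / (2 ^+ n / n%:R `^ (3 / 2)) <= 1.
Proof.
move=> n0; rewrite invf_div mulrA mulrAC.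
have p0 : 0 <= n%:R `^ (3 / 2) :> R by exact: powR_ge0.
have p2 : (n%:R `^ (3 / 2)) ^+ 2 = n%:R ^+ 3 :> R.
  by rewrite -powR_mulrn// -powRrM -powR_mulrn//; congr (_ `^ _); lra.
have := discrepancy_normalized_bounds R n0; rewrite -p2 -exprMn => /andP[lo hi].
have x0 : 0 <= discrepancy R n / 2 ^+ n * n%:R `^ (3 / 2).
  by rewrite mulr_ge0// divr_ge0 ?discrepancy_ge0// exprn_ge0.
move: (_ * _ `^ _) lo hi x0 => x lo hi x0.
apply/andP; split; last by rewrite -(@expr_le1 _ 2).
rewrite -ler_sqr ?nnegrE//.
by apply: le_trans lo; rewrite expr2; lra.
Qed.

(** * Inverting the path operator on complex sequences *)

Section ComplexSequences.
Variable R : realType.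
Local Notation C := R[i].
Local Notation normc := (@Normc.normc R).
Implicit Types (u z : C) (f g h p w : nat -> C).

Lemma normcX u n : normc (u ^+ n) = normc u ^+ n.
Proof.
by elim: n => [|n IHn]; rewrite ?Normc.normc1// !exprS Normc.normcM IHn.
Qed.

Lemma normcB u z : normc (u - z) <= normc u + normc z.
Proof. by rewrite (le_trans (normc_triangle _ _))// normcN. Qed.

Lemma normc_gt0 u : u != 0 -> 0 < normc u.
Proof.
move=> u0; rewrite lt_neqAle normc_ge0 andbT eq_sym.
by apply: contra u0 => /eqP/Normc.eq0_normc/eqP.
Qed.

Lemma normc_Re_Im u :
  [/\ `|complex.Re u| <= normc u, `|complex.Im u| <= normc u
    & normc u <= `|complex.Re u| + `|complex.Im u|].
Proof.
case: u => a b /=; have ab : 0 <= a ^+ 2 + b ^+ 2 by rewrite addr_ge0// sqr_ge0.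
split.
- by rewrite -sqrtr_sqr ler_wsqrtr// lerDl sqr_ge0.
- by rewrite -sqrtr_sqr ler_wsqrtr// lerDr sqr_ge0.
rewrite -[leRHS]ger0_norm ?addr_ge0// -[leRHS]sqrtr_sqr ler_wsqrtr//.
rewrite sqrrD !real_normK ?num_real// addrAC -[leLHS]addr0.
by rewrite lerD2l// mulrn_wge0// mulr_ge0.
Qed.

Lemma complex_geometric_cauchy (s : nat -> C) (c r : R) : 0 <= r < 1 ->
    (forall n, normc (s n.+1 - s n) <= c * r ^+ n) ->
  exists l, forall n, normc (s n - l) <= 2 * c / (1 - r) * r ^+ n.
Proof.
move=> r01 sr.
have [a Ha] : exists l, forall n,
    `|complex.Re (s n) - l| <= c / (1 - r) * r ^+ n.
  apply: geometric_cauchy => // n; apply: le_trans (sr n).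
  have [+ _ _] := normc_Re_Im (s n.+1 - s n).
  by case: (s n.+1) (s n) => [? ?] [? ?].
have [b Hb] : exists l, forall n,
    `|complex.Im (s n) - l| <= c / (1 - r) * r ^+ n.
  apply: geometric_cauchy => // n; apply: le_trans (sr n).
  have [_ + _] := normc_Re_Im (s n.+1 - s n).
  by case: (s n.+1) (s n) => [? ?] [? ?].
exists (Complex a b) => n; have := Ha n; have := Hb n.
have [_ _] := normc_Re_Im (s n - Complex a b).
case: (s n) => x y; rewrite [complex.Re _]/= [complex.Im _]/=.
by rewrite -!mulrA; move: (normc _) => t /=; lra.
Qed.

(** Convergence to 0, phrased with the real modulus so that all estimates stay
    among real numbers. *)
Definition vanishing f :=
  forall e : R, 0 < e -> \forall n \near \oo, normc (f n) <= e.

Lemma vanishingD f g :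
  vanishing f -> vanishing g -> vanishing (fun n => f n + g n).
Proof.
move=> f0 g0 e e0; have e2 : 0 < e / 2 by lra.
have [N _ fN] := f0 _ e2; have [m _ gm] := g0 _ e2.
exists (N + m)%N => // n /= Nmn; apply: le_trans (normc_triangle _ _) _.
have := fN n (leq_trans (leq_addr _ _) Nmn).
have := gm n (leq_trans (leq_addl _ _) Nmn).
by move: (normc _) (normc _) => x y /=; lra.
Qed.

Lemma vanishing_geometric u (a : C) :
  normc u < 1 -> vanishing (fun n => a * u ^+ n).
Proof.
move=> u1 e e0; have u01 : 0 <= normc u < 1 by rewrite normc_ge0.
have [N _ aN] := geometric_eventually_le (normc a) u01 e0.
by exists N => // n /aN; rewrite Normc.normcM normcX.
Qed.

(** Inverts [1 - u S] for the shift [S h i = h (i+1)] by the series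
    [sum_k u^k g (i+k)]. *)
Lemma backward_solution u g (c : R) :
    normc u < 1 -> (forall i, normc (g i) <= c) ->
  exists h, (forall i, h i = g i + u * h i.+1) /\
    exists c', forall i, normc (h i) <= c'.
Proof.
move=> u1 gc; pose s i n := \sum_(k < n) u ^+ k * g (i + k)%N.
have u01 : 0 <= normc u < 1 by rewrite normc_ge0.
have sS i n : s i n.+1 = g i + u * s i.+1 n.
  rewrite /s big_ord_recl mul1r addn0 mulr_sumr; congr (_ + _).
  by apply: eq_bigr => k _; rewrite exprS mulrA /= /bump /= add1n addnS addSn.
have /choice[h hs] : forall i, exists l, forall n,
    normc (s i n - l) <= 2 * c / (1 - normc u) * normc u ^+ n.
  move=> i; apply: complex_geometric_cauchy => // n.
  rewrite /s big_ord_recr /= addrAC subrr add0r Normc.normcM normcX mulrC.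
  by rewrite ler_wpM2r// exprn_ge0// normc_ge0.
exists h; split; last first.
  exists (2 * c / (1 - normc u)) => i.
  by have := hs i 0%N; rewrite /s big_ord0 sub0r normcN mulr1.
move=> i; apply/eqP; rewrite -subr_eq0; apply/eqP/Normc.eq0_normc.
apply/le_anti; rewrite normc_ge0 andbT.
apply: (@geometric_le0 R (normc u) _
  (2 * (2 * c / (1 - normc u)) * normc u)) => // n.
have -> : h i - (g i + u * h i.+1) =
    - (s i n.+1 - h i) + u * (s i.+1 n - h i.+1) by rewrite sS; ring.
apply: le_trans (normc_triangle _ _) _; rewrite normcN Normc.normcM.
have := hs i n.+1; have := ler_wpM2l (normc_ge0 u) (hs i.+1 n).
by rewrite exprS; move: (normc (_ - _)) (_ * normc _) => x y; lra.
Qed.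

Lemma vanishing_backward u g h (c : R) :
    normc u < 1 -> (forall i, h i = g i + u * h i.+1) ->
    (forall i, normc (h i) <= c) -> vanishing g -> vanishing h.
Proof.
move=> u1 hE hc g0 e e0.
have d0 : 0 < e * (1 - normc u) by rewrite mulr_gt0//; lra.
have [N _ gN] := g0 _ d0; exists N => // i /= Ni.
rewrite -subr_le0; apply: (@geometric_le0 R (normc u) _ c).
  by rewrite normc_ge0.
move=> n; rewrite lerBlDr addrC; elim: n i Ni => [|n IHn] i Ni.
  by rewrite mulr1; have := hc i; lra.
rewrite hE; apply: le_trans (normc_triangle _ _) _.
have := gN _ Ni; rewrite Normc.normcM.
have := ler_wpM2l (normc_ge0 u) (IHn i.+1 (leqW Ni)).
by rewrite exprS; lra.
Qed.

(** The inverse of [1 - u L] for the shift [L p i = p (i-1)], [L p 0 = 0]. *)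
Fixpoint forward u h (i : nat) : C :=
  if i is k.+1 then h k.+1 + u * forward u h k else h 0%N.

Lemma vanishing_forward u h :
  normc u < 1 -> vanishing h -> vanishing (forward u h).
Proof.
move=> u1 h0 e e0.
have d0 : 0 < e / 2 * (1 - normc u) by rewrite mulr_gt0//; lra.
have [N _ hN] := h0 _ d0.
set c := normc (forward u h N).
have H n : normc (forward u h (N + n)) <= e / 2 + c * normc u ^+ n.
  elim: n => [|n IHn]; first by rewrite addn0 mulr1 -/c; lra.
  rewrite addnS /=; apply: le_trans (normc_triangle _ _) _.
  have := hN (N + n).+1 (leqW (leq_addr _ _)); rewrite Normc.normcM.
  have := ler_wpM2l (normc_ge0 u) IHn; rewrite exprS.
  by move: (normc (h _)) (normc (forward _ _ _)) => x y; lra.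
have u01 : 0 <= normc u < 1 by rewrite normc_ge0.
have e2 : 0 < e / 2 by lra.
have [m _ cm] := geometric_eventually_le c u01 e2.
exists (N + m)%N => // i /= Nmi.
rewrite -(subnKC (leq_trans (leq_addr m N) Nmi)); apply: le_trans (H _) _.
have /cm /= : (m <= i - N)%N by rewrite leq_subRL// (leq_trans _ Nmi) ?leq_addr.
by lra.
Qed.

(** Wiener-Hopf factorization: as [S L = 1] on the half-line,
    [(1 - u S) (1 - u L) = 1 + u^2 - u (S + L)], which is [u (u + u^-1 - T)]. *)
Lemma path_op_solution u g (c : R) : u != 0 ->
    normc u < 1 -> vanishing g -> (forall i, normc (g i) <= c) ->
  exists2 p, vanishing p & forall l, (u + u^-1) * p l - path_op p l = g l.
Proof.
move=> u0 u1 g0 gc.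
have gc' i : normc (u * g i) <= c.
  rewrite Normc.normcM (le_trans _ (gc i))// ler_piMl ?normc_ge0//; exact: ltW.
have [h [hE [c' hc']]] := backward_solution u1 gc'.
have ug0 : vanishing (fun i => u * g i).
  move=> e e0; have [N _ gN] := g0 _ e0; exists N => // i /gN.
  apply: le_trans; rewrite Normc.normcM ler_piMl ?normc_ge0//; exact: ltW.
exists (forward u h).
  by apply: vanishing_forward => //; exact: (vanishing_backward u1 hE hc').
move=> l; apply: (mulfI u0).
have <- : h l - u * h l.+1 = u * g l by rewrite {1}hE addrK.
by case: l => [|l]; rewrite /path_op /=; field.
Qed.

(** The operator [T] has norm at most 2, so [z - T] is bounded below by
    [|z| - 2]; boundedness of [w] starts the iteration. *)
Lemma path_op_bound z w (b c : R) : 2 < normc z ->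
    (forall l, normc (w l) <= c) ->
    (forall l, normc (z * w l - path_op w l) <= b) ->
  forall l, normc (w l) <= b / (normc z - 2).
Proof.
move=> z2 wc wb l; have z0 : 0 < normc z by lra.
rewrite -subr_le0.
apply: (@geometric_le0 R (2 / normc z) _ (c + `|b / (normc z - 2)|)).
  by rewrite divr_ge0 ?normc_ge0//= ltr_pdivrMr//; lra.
move=> n; rewrite lerBlDr addrC.
elim: n l => [|n IHn] l.
  have := wc l; have := ler_norm (- (b / (normc z - 2))).
  by rewrite mulr1 normrN; lra.
have zw : normc z * normc (w l) <= b + normc (path_op w l).
  rewrite -Normc.normcM -[z * w l](subrK (path_op w l)).
  by apply: le_trans (normc_triangle _ _) _; rewrite lerD2r.
set B := _ + _ in IHn.
have B0 : 0 <= B by exact: le_trans (normc_ge0 _) (IHn 0%N).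
have Tw : normc (path_op w l) <= 2 * B.
  apply: le_trans (normc_triangle _ _) _; have := IHn l.+1.
  by case: l {zw} => [|l]; rewrite ?Normc.normc0; [|have := IHn l]; lra.
rewrite -(ler_pM2l z0); apply: (@le_trans _ _ (b + 2 * B)); first by lra.
rewrite le_eqVlt; apply/orP; left; apply/eqP; rewrite /B exprS; field.
by apply/andP; split; apply: lt0r_neq0; lra.
Qed.

(** The two roots of [u^2 - z u + 1] are inverse to each other, and if both had
    modulus 1 their sum [z] would have modulus at most 2. *)
Lemma joukowski_root z : 2 < normc z ->
  exists u, [/\ u != 0, normc u < 1 & z = u + u^-1].
Proof.
move=> z2; pose s := sqrtc ((z / 2) ^+ 2 - 1).
have ss := sqr_sqrtc ((z / 2) ^+ 2 - 1).
have E : (z / 2 + s) * (z / 2 - s) = 1.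
  by rewrite mulrC -subr_sqr /s ss opprB addrC subrK.
have F : z = (z / 2 + s) + (z / 2 - s) by field.
have [a0 b0] : z / 2 + s != 0 /\ z / 2 - s != 0.
  by split; apply/eqP => e0; move: E; rewrite e0 ?mul0r ?mulr0 => /eqP;
    rewrite eq_sym oner_eq0.
have a1 : z / 2 - s = (z / 2 + s)^-1 by apply: (mulfI a0); rewrite E mulfV.
have b1 : z / 2 + s = (z / 2 - s)^-1 by rewrite a1 invrK.
have NE : normc (z / 2 + s) * normc (z / 2 - s) = 1.
  by rewrite -Normc.normcM E Normc.normc1.
have NF : normc z <= normc (z / 2 + s) + normc (z / 2 - s).
  by rewrite {1}F normc_triangle.
have [lt|ge] := ltP (normc (z / 2 + s)) 1.
  by exists (z / 2 + s); split=> //; rewrite -a1.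
exists (z / 2 - s); split=> //; last by rewrite -b1 addrC.
have := normc_ge0 (z / 2 - s); set x := normc (_ + _) in NE NF ge *.
by move: (normc (_ - _)) NE NF => y NE NF y0; nra.
Qed.

End ComplexSequences.

(** * The spectrum of the substitution operator *)

(** The lower bound makes the inverse, which choice provides pointwise, linear
    and continuous. *)
Lemma resolvent_setP (K : numFieldType) (V : normedModType K)
    (T : {linear V -> V}) (z c : K) :
    0 <= c -> (forall v, exists w, z *: w - T w = v) ->
    (forall w, `|w| <= c * `|z *: w - T w|) ->
  resolvent_set T z.
Proof.
move=> c0 /choice[S SE] bound.
have inj v w : z *: v - T v = z *: w - T w -> v = w.
  move=> vw; apply/eqP; rewrite -subr_eq0 -normr_le0.
  rewrite (le_trans (bound _))// scalerBr (linearB T) opprD opprK addrACA.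
  by rewrite vw addrACA subrr addNr addr0 normr0 mulr0.
have Slin : linear S.
  by move=> a v w; apply: inj; rewrite SE (linearP T) scalerDr scalerA mulrC
    -scalerA opprD addrACA -scalerBr !SE.
pose SL := GRing.isLinear.Build K V V _ S Slin.
pose S' : {linear V -> V} := HB.pack S SL.
exists S'; split=> [|v|v] /=.
- apply: (@bounded_linear_continuous _ _ _ S').
  apply/(@bounded_funP _ _ _ S') => r; exists (c * r) => v vr.
  by apply: le_trans (bound _) _; rewrite SE ler_wpM2l.
- by apply: inj; rewrite SE.
- exact: SE.
Qed.

Section Operator.
Variable R : realType.
Local Notation C := R[i].
Local Notation normc := (@Normc.normc R).
Local Notation M := (@substitution_operator R).
Implicit Types (f v w : calphabet R) (z : C).

Lemma substitution_operator_letter f l :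
  M f (letter l) = f (letter 0) + path_op (fun i => f (letter i)) l.
Proof.
rewrite -[LHS]/(substitution_fun f (letter l)) /substitution_fun /path_op.
by case: l => [|l]; rewrite !big_cons big_nil ?addr0// [X in _ + X]addrC.
Qed.

Lemma substitution_operator_oo f :
  M f letter_oo = f (letter 0) + 2 * f letter_oo.
Proof.
rewrite -[LHS]/(substitution_fun f letter_oo) /substitution_fun.
rewrite !big_cons big_nil addr0.
by rewrite mulr2n mulrDl mul1r.
Qed.

Lemma cfun_ext v w :
    (forall l, v (letter l) = w (letter l)) -> v letter_oo = w letter_oo ->
  v = w.
Proof. by move=> vw vwoo; apply/val_inj/funext => -[l|]; [exact: vw|]. Qed.

Lemma resolventE z f a : (z *: f - M f) a = z * f a - M f a.
Proof. by []. Qed.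

Lemma cfun_vanishing f : vanishing (fun n => f (letter n) - f letter_oo).
Proof.
move=> e e0.
have fn : f (letter n) @[n --> \oo] --> f letter_oo.
  by move=> U /cfun_continuous /(nbhs_letter_oo R)[].
have e0' : 0 < e%:C%C :> R[i] by rewrite ltcR.
have nF : ProperFilter (f (letter n) @[n --> \oo]) by exact: fmap_proper_filter.
move/cvgrPdist_le : fn => /(_ _ e0') [N _ fN]; exists N => // n /fN /=.
by rewrite -normrN opprB -lecR.
Qed.

Lemma cfun_of_vanishing (g : nat -> C) (l : C) :
  vanishing (fun n => g n - l) ->
  exists f, (forall n, f (letter n) = g n) /\ f letter_oo = l.
Proof.
move=> gl; pose F (a : alphabet) : R[i]^o := if a is Some n then g n else l.
have cF : F \in continuous_functions R.
  apply/continuous_functionsP => -[n|].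
    by move=> U /nbhs_singleton HU; apply/principal_filterP.
  have gn : (g n : R[i]^o) @[n --> \oo] --> (l : R[i]^o).
    apply/(@cvgrPdist_le _ R[i]^o) => -[e e'] e0.
    move: e0; rewrite ltcE /= => /andP[/eqP -> e0'].
    have [N _ gN] := gl e e0'; exists N => // n /gN /=.
    by rewrite distrC -lecR.
  move=> U HU; apply/(nbhs_letter_oo R); split.
    exact: (@nbhs_singleton R[i]^o l U HU).
  exact: (gn U HU).
by exists (CAlphabet cF).
Qed.

(** A preimage of the Dirac mass at 0 under [2 - M] vanishes at the letter 0, by
    the equation at infinity, and is then harmonic, hence linear and
    unbounded. *)
Lemma two_in_spectrum : spectrum M 2.
Proof.
move=> [S [_ _ SE]].
have v0 : vanishing (fun n => (n == 0%N)%:R - 0 : C).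
  move=> e e0; exists 1%N => // -[//|n] _.
  by rewrite /= subr0 expr0n addr0 sqrtr0 ltW.
have [v [vn voo]] := cfun_of_vanishing v0.
have wE a : 2 * S v a - M (S v) a = v a by rewrite -resolventE SE.
move: (S v) wE => w {SE v0} wE.
have w0 : w (letter 0) = 0.
  have := wE letter_oo.
  rewrite substitution_operator_oo voo opprD addrCA subrr addr0.
  by move/eqP; rewrite oppr_eq0 => /eqP.
have wS l : w (letter l) = - l%:R /\ w (letter l.+1) = - l.+1%:R.
  elim: l => [|l [IH IH']].
    split; first by rewrite w0 oppr0.
    have := wE (letter 0); rewrite substitution_operator_letter vn w0 /path_op.
    by rewrite mulr0 !add0r addr0 => <-; rewrite opprK.
  split=> //; have := wE (letter l.+1).
  rewrite substitution_operator_letter vn w0 /path_op IH IH' add0r => E.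
  have -> : w (letter l.+2) = 2 * - l.+1%:R + l%:R.
    by move: E => /eqP; rewrite subr_eq add0r => /eqP ->; rewrite subrK.
  by rewrite -[l.+2%:R]natr1 -[l.+1%:R]natr1; ring.
have H n : n%:R <= sup_norm w.
  apply: le_trans (sup_norm_ge w (letter n)); have [-> _] := wS n.
  by rewrite normcN normcMn Normc.normc1.
by have := archi_boundP (H 0%N); rewrite ltNge H.
Qed.

(** The eigenvector is [2 - 2^(-l)], with limit 2 and value 1 at 0, which
    balances the restart term: [1 + 2 * 2 = 5/2 * 2]. *)
Lemma five_halves_in_spectrum : spectrum M (5 / 2).
Proof.
move=> [S [_ SE _]].
have f0 : vanishing (fun n => (2 - 2^-1 ^+ n) - 2 : C).
  have -> : (fun n => (2 - 2^-1 ^+ n) - 2 : C) = (fun n => -1 * 2^-1 ^+ n).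
    by apply/funext => n; ring.
  apply: vanishing_geometric.
  by rewrite Normc.normcV normcMn Normc.normc1 invf_lt1 ?ltr1n.
have [f [fn foo]] := cfun_of_vanishing f0.
have fE : (5 / 2) *: f - M f = 0.
  have E0 a : (0 : calphabet R) a = 0 by [].
  apply: cfun_ext => [l|]; rewrite resolventE E0.
    rewrite substitution_operator_letter /path_op.
    by case: l => [|l]; rewrite !fn ?exprS; field.
  by rewrite substitution_operator_oo foo fn; field.
have := SE f; rewrite fE linear0 => f00.
by have := foo; rewrite -f00 => /eqP; rewrite eq_sym pnatr_eq0.
Qed.

(** Rank-one perturbation: with [h = (z - T)^-1 1], the equation
    [(z - M) w = v] reads [w - w 0 * h = (z - T)^-1 v], whose value at 0
    determines [w 0] as soon as [h 0 <> 1]. This gives existence, and it gives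
    the bound on [w] in terms of [v]. *)
Lemma resolvent_outside z :
  2 < normc z -> z != 5 / 2 -> resolvent_set M z.
Proof.
move=> z2 z52; have [u [u0 u1 zE]] := joukowski_root z2.
have u_neq1 : 1 - u != 0.
  by rewrite subr_eq0; apply: contraTneq u1 => <-; rewrite Normc.normc1 ltxx.
have u_neq2 : 1 - 2 * u != 0.
  apply: contra z52 => /eqP e; apply/eqP.
  have -> : z = u + u^-1 by [].
  have -> : u = 2^-1.
    move: e => /eqP; rewrite subr_eq0 => /eqP e.
    by apply: (@mulfI _ 2) => //; rewrite -e mulfV.
  by field.
have z_neq2 : z - 2 != 0.
  have -> : z - 2 = (1 - u) ^+ 2 / u by rewrite zE; field.
  by rewrite mulf_neq0 ?invr_eq0 ?expf_neq0.
(* The constant [1 / (z - 2)] corrected by the decaying solution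
   [u^(l+1)] of the recurrence so as to vanish at [l = -1]. *)
pose h l := (1 - u ^+ l.+1) / (z - 2).
have hE l : z * h l - path_op h l = 1.
  have -> : path_op h l = (2 - (u + u^-1) * u ^+ l.+1) / (z - 2).
    case: l => [|l]; rewrite /path_op /h ?exprS ?expr0; field;
      by rewrite ?z_neq2 ?u0.
  by rewrite -zE /h; field.
have h0 : 1 - h 0%N != 0.
  have -> : 1 - h 0%N = (1 - 2 * u) / (1 - u).
    have z2E : z - 2 = (1 - u) ^+ 2 / u by rewrite zE; field.
    by rewrite /h z2E expr1; field; rewrite u0 u_neq1.
  by rewrite mulf_neq0 ?invr_eq0.
pose H := 2 / normc (z - 2).
have hH l : normc (h l) <= H.
  rewrite /h Normc.normcM Normc.normcV ler_wpM2r ?invr_ge0 ?normc_ge0//.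
  apply: le_trans (normcB _ _) _; rewrite Normc.normc1 normcX.
  by have := exprn_ile1 l.+1 (normc_ge0 u) (ltW u1); lra.
(* For [v] of norm 1, [c1] bounds [(z - T)^-1 v], [c2] bounds [w 0] and [c3]
   bounds the value of [w] at infinity. *)
pose c1 := (normc z - 2)^-1.
pose c2 := c1 / normc (1 - h 0%N).
pose c3 := (1 + c2) / normc (z - 2).
have H0 : 0 <= H by exact: le_trans (normc_ge0 _) (hH 0%N).
have c10 : 0 <= c1 by rewrite invr_ge0; lra.
have c20 : 0 <= c2 by rewrite divr_ge0// normc_ge0.
have c30 : 0 <= c3 by rewrite divr_ge0 ?normc_ge0//; lra.
apply: (@resolvent_setP _ _ M z (c1 + c2 * H + c3)%:C%C).
- by rewrite ler0c !addr_ge0// mulr_ge0.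
- move=> v.
  have [p p0 pE] : exists2 p, vanishing p & forall l,
      z * p l - path_op p l = v (letter l) - v letter_oo.
    rewrite zE; apply: (path_op_solution u0 u1 (cfun_vanishing v)
      (c := sup_norm v + sup_norm v)) => i.
    by apply: le_trans (normcB _ _) _; rewrite lerD ?sup_norm_ge.
  (* The solution is [p + d * h], whose value at the letter 0 is [c]. *)
  pose c := (p 0%N + v letter_oo * h 0%N) / (1 - h 0%N).
  pose d := v letter_oo + c.
  have c0 : p 0%N + d * h 0%N = c by rewrite /d /c; field.
  have w0 : vanishing (fun n => (p n + d * h n) - d / (z - 2)).
    have -> : (fun n => (p n + d * h n) - d / (z - 2)) =
        (fun n => p n + (- d * u / (z - 2)) * u ^+ n).
      by apply/funext => n; rewrite /h exprS; ring.
    by apply: vanishingD => //; exact: vanishing_geometric.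
  have [w [wn woo]] := cfun_of_vanishing w0; exists w.
  apply: cfun_ext => [l|]; rewrite resolventE.
    rewrite substitution_operator_letter (wn l) (wn 0%N) c0.
    have -> : path_op (fun i => w (letter i)) l = path_op p l + d * path_op h l.
      by rewrite -path_opZ -path_opD; apply: eq_path_op => i; rewrite wn.
    have := pE l; have := hE l; rewrite /d.
    move: (path_op _ _) (path_op _ _) => A B E1 E2.
    have -> : B = z * h l - 1 by rewrite -E1; ring.
    have -> : A = z * p l - (v (letter l) - v letter_oo) by rewrite -E2; ring.
    by ring.
  by rewrite substitution_operator_oo wn c0 woo /d; field.
move=> w; set v := z *: w - M w.
have vl l : z * w (letter l) - w (letter 0) -
    path_op (fun i => w (letter i)) l = v (letter l).
  by rewrite -addrA -opprD -substitution_operator_letter.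
have voo : (z - 2) * w letter_oo = v letter_oo + w (letter 0).
  by rewrite /v resolventE substitution_operator_oo; ring.
pose y l := w (letter l) - w (letter 0) * h l.
have yb l : normc (y l) <= sup_norm v / (normc z - 2).
  apply: (@path_op_bound _ z y _ (sup_norm w + sup_norm w * H) z2) => i.
    apply: le_trans (normcB _ _) _; rewrite lerD ?sup_norm_ge// Normc.normcM.
    by rewrite ler_pM ?normc_ge0 ?sup_norm_ge.
  have -> : z * y i - path_op y i = v (letter i); last exact: sup_norm_ge.
  have -> : path_op y i =
      path_op (fun i => w (letter i)) i - w (letter 0) * path_op h i.
    rewrite -mulNr -path_opZ -path_opD.
    by apply: eq_path_op => k; rewrite mulNr.
  rewrite -vl -[w (letter 0) in RHS]mulr1 -(hE i) /y; ring.
have wb0 : normc (w (letter 0)) <= c2 * sup_norm v.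
  have := yb 0%N; rewrite /y -{1}[w _]mulr1 -mulrBr Normc.normcM.
  by rewrite -ler_pdivlMr ?normc_gt0// /c2 /c1 [X in _ -> _ <= X]mulrC mulrA.
rewrite -rmorphM lecR; apply: sup_norm_le => a.
have V0 : 0 <= sup_norm v.
  exact: le_trans (normc_ge0 _) (sup_norm_ge v letter_oo).
have s1 : 0 <= c1 * sup_norm v by exact: mulr_ge0.
have s2 : 0 <= c2 * H * sup_norm v by rewrite mulr_ge0// (mulr_ge0 c20).
have s3 : 0 <= c3 * sup_norm v by exact: mulr_ge0.
case: a => [l|].
  have -> : w (Some l) = y l + w (letter 0) * h l by rewrite subrK.
  apply: le_trans (normc_triangle _ _) _.
  have := yb l; rewrite Normc.normcM mulrC -/c1.
  have := ler_pM (normc_ge0 _) (normc_ge0 _) wb0 (hH l).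
  by rewrite mulrAC; lra.
have -> : w None = (v letter_oo + w (letter 0)) / (z - 2).
  by rewrite -voo mulrAC mulfV// mul1r.
rewrite Normc.normcM Normc.normcV.
apply: (@le_trans _ _ (c3 * sup_norm v)); last lra.
rewrite /c3 mulrAC ler_wpM2r ?invr_ge0 ?normc_ge0//.
apply: le_trans (normc_triangle _ _) _.
by rewrite mulrDl mul1r lerD ?sup_norm_ge.
Qed.

Lemma spectrum_bound z : spectrum M z -> z = 5 / 2 \/ normc z <= 2.
Proof.
move=> Mz; have [->|z52] := eqVneq z (5 / 2); first by left.
by right; rewrite leNgt; apply/negP => z2; exact/Mz/resolvent_outside.
Qed.

Lemma five_halvesE : (5 / 2 : R)%:C%C = 5 / 2 :> C.
Proof. by rewrite rmorphM fmorphV !rmorph_nat. Qed.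

Lemma normc_real (x : R) : 0 <= x -> normc x%:C%C = x.
Proof. by move=> x0; rewrite /= expr0n addr0 sqrtr_sqr ger0_norm. Qed.

Lemma inflation_factorE : inflation_factor R = 5 / 2.
Proof.
apply/le_anti/andP; split.
  apply: ge_sup.
    exists (normc (5 / 2)), (5 / 2) => //; exact: five_halves_in_spectrum.
  move=> _ [z /spectrum_bound[->|z2] <-]; last by apply: le_trans z2 _; lra.
  by rewrite -five_halvesE normc_real.
apply: ub_le_sup.
  exists (5 / 2) => _ [z /spectrum_bound[->|z2] <-]; last first.
    by apply: le_trans z2 _; lra.
  by rewrite -five_halvesE normc_real.
exists (5 / 2); first exact: five_halves_in_spectrum.
by rewrite -five_halvesE normc_real.
Qed.

Lemma second_radiusE : second_radius R = 2.
Proof.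
have n2 : normc 2 = 2 by rewrite normcMn Normc.normc1.
have in2 : [set normc z | z in spectrum M `\ (inflation_factor R)%:C%C] 2.
  exists 2 => //; split; first exact: two_in_spectrum.
  move=> /= /(congr1 normc); rewrite inflation_factorE normc_real// n2; lra.
have ub2 : ubound
    [set normc z | z in spectrum M `\ (inflation_factor R)%:C%C] 2.
  move=> _ [z [/spectrum_bound[zE|z2] zN] <-] //.
  by case: zN; rewrite /= inflation_factorE five_halvesE.
apply/le_anti/andP; split; first by apply: ge_sup => //; exists 2.
by apply: ub_le_sup => //; exists 2.
Qed.

End Operator.

Theorem theorem3p2 (R : realType) :
  [/\ Theta (fun n : nat => 2 ^+ n / n%:R `^ (3 / 2))
        (fun n : nat => (tiles n)%:R - 3 / 4 * (5 / 2) ^+ n : R),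
      second_radius R = 2
    & forall n : nat, (1 <= n)%N ->
        `|3 / 4 * (5 / 2) ^+ n - (tiles n)%:R| <=
          n%:R `^ (- (3 / 2)) * second_radius R ^+ n].
Proof.
have dE n : `|(tiles n)%:R - 3 / 4 * (5 / 2) ^+ n| = discrepancy R n.
  by rewrite tiles_discrepancy addrAC subrr add0r ger0_norm ?discrepancy_ge0.
have g0 n : (0 < n)%N -> 0 < 2 ^+ n / n%:R `^ (3 / 2) :> R.
  by move=> n0; rewrite divr_gt0 ?exprn_gt0 ?powR_gt0 ?ltr0n.
split; first 1 last.
- exact: second_radiusE.
- move=> n n0; rewrite second_radiusE distrC dE powRN mulrC.
  have /andP[_] := discrepancy_scaled_bounds R n0.
  by rewrite ler_pdivrMr ?g0// mul1r.
apply: (@Theta_bounds _ _ _ (1 / 40) 1); first lra.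
  by exists 1%N => // n; exact: g0.
exists 1%N => // n n0; rewrite dE; exact: discrepancy_scaled_bounds.
Qed.
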